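(* Let $\mathbb{K}$ be an algebraically closed field of characteristic $0$ and let $p\ge 4$ be an integer. Then any $\mathfrak{g}\in\mathcal{F}^{3p+1,3}_{p,0,1}$ is not rigid in $3Nilp_{3p+1}$.
   Context: $3Nilp_n$ is the algebraic variety of all Lie brackets $\mu$ on $\mathbb{K}^n$ satisfying $\mu(\mu(\mu(X,Y),Z),T)=0$ for all $X,Y,Z,T$ (viewed in $\mathbb{K}^{n^3}$ via structure constants); a Lie algebra $(\mathbb{K}^n,\mu)$ is identified with $\mu$. The group $GL(n,\mathbb{K})$ acts by $(f\cdot\mu)(X,Y)=f^{-1}\mu(f(X),f(Y))$. $\mu\in 3Nilp_n$ is rigid in $3Nilp_n$ if its orbit is Zariski open in $3Nilp_n$. For a nilpotent Lie algebra $\mathfrak{g}$ and $X\in\mathfrak{g}$, $c(X)$ is the decreasing sequence of the dimensions of the Jordan blocks of $\mathrm{ad}(X)$; the characteristic sequence of $\mathfrak{g}$ is $c(\mathfrak{g})=\max\{c(X): X\in\mathfrak{g}\setminus[\mathfrak{g},\mathfrak{g}]\}$ for the lexicographic order. $\mathcal{F}^{3p+1,3}_{p,0,1}$ is the family of $(3p+1)$-dimensional $3$-step nilpotent Lie algebras over $\mathbb{K}$ with characteristic sequence $(3,\dots,3,1)$, where $3$ appears $p$ times. *)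

(* Defs.v *)
From HB Require Import structures.
From mathcomp Require Import all_boot all_order all_algebra.
From mathcomp Require Import mpoly.

Set Implicit Arguments.
Unset Strict Implicit.
Unset Printing Implicit Defensive.

Import Order.TTheory GRing.Theory.
Local Open Scope ring_scope.

Section LieAlgebraLaws.

Variables (K : fieldType) (n : nat).

(* Points of K^(n^3): [mu (i, j, k)] is the coefficient of e_k in mu(e_i, e_j). *)
Definition structure_constants := {ffun 'I_n * 'I_n * 'I_n -> K}.

Implicit Types (mu nu : structure_constants) (X Y Z T : 'rV[K]_n).

Definition bracket mu X Y : 'rV[K]_n :=
  \row_k \sum_i \sum_j X 0 i * Y 0 j * mu (i, j, k).

Definition is_lie_bracket mu : Prop :=
  (forall X, bracket mu X X = 0) /\
  (forall X Y Z, bracket mu (bracket mu X Y) Z +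
                 bracket mu (bracket mu Y Z) X +
                 bracket mu (bracket mu Z X) Y = 0).

Definition in_3Nilp mu : Prop :=
  is_lie_bracket mu /\
  (forall X Y Z T, bracket mu (bracket mu (bracket mu X Y) Z) T = 0).

(* Nilpotent of nilindex exactly 3. *)
Definition three_step_nilpotent mu : Prop :=
  in_3Nilp mu /\ (exists X Y Z, bracket mu (bracket mu X Y) Z != 0).

(* Vectors are rows, so f in GL(n, K) acts by X |-> X *m f.  [in_GL_orbit mu nu]
   says that nu = f . mu for some f, where
   (f . mu)(X, Y) = f^-1 (mu (f X, f Y)). *)
Definition in_GL_orbit mu nu : Prop :=
  exists2 f : 'M[K]_n, f \in unitmx &
    forall X Y, bracket nu X Y = bracket mu (X *m f) (Y *m f) *m invmx f.

Definition sc_poly := {mpoly K[#|{: 'I_n * 'I_n * 'I_n}|]}.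

Definition sc_eval (P : sc_poly) mu : K := P.@[fun a => mu (enum_val a)].

Definition zariski_closed (C : structure_constants -> Prop) : Prop :=
  exists S : sc_poly -> Prop,
    forall mu, C mu <-> (forall P, S P -> sc_eval P mu = 0).

Definition zariski_open (U : structure_constants -> Prop) : Prop :=
  zariski_closed (fun mu => ~ U mu).

Definition rigid_in_3Nilp mu : Prop :=
  in_3Nilp mu /\
  exists2 U : structure_constants -> Prop, zariski_open U &
    forall nu, in_GL_orbit mu nu <-> in_3Nilp nu /\ U nu.

(* [g, g]; by bilinearity the brackets of basis vectors span it. *)
Definition derived_algebra mu : {vspace 'rV[K]_n} :=
  span [seq bracket mu (delta_mx 0 ij.1) (delta_mx 0 ij.2)
         | ij : 'I_n * 'I_n].

(* v *m ad mu X = bracket mu X v *)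
Definition ad mu X : 'M[K]_n := lin1_mx (bracket mu X).

End LieAlgebraLaws.

Section JordanBlocks.

Variable K : fieldType.

Definition jordan_block (m : nat) (a : K) : 'M[K]_m :=
  a%:M + \matrix_(i, j) (i.+1 == j :> nat)%:R.

Definition jordan_matrix (s : seq nat) (a : 'I_(size s) -> K) :
    'M[K]_(\sum_(i < size s) nth 0%N s i) :=
  \mxdiag_(i < size s) jordan_block (nth 0%N s i) (a i).

(* s is the decreasing sequence of the dimensions of the Jordan blocks of A.
   The sum of s equals n only propositionally, so the change of basis P is a
   rectangular matrix of full row and column rank, i.e. an invertible one. *)
Definition jordan_sizes (n : nat) (A : 'M[K]_n) (s : seq nat) : Prop :=
  [/\ sorted geq s, all (leq 1) s &
      exists (a : 'I_(size s) -> K)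
             (P : 'M[K]_(\sum_(i < size s) nth 0%N s i, n)),
        [/\ row_free P, row_full P & P *m A = jordan_matrix a *m P]].

(* The order of [seqlexi nat] is the lexicographic order. *)
Definition characteristic_sequence (n : nat) (mu : structure_constants K n)
    (s : seq nat) : Prop :=
  (exists2 X, X \notin derived_algebra mu & jordan_sizes (ad mu X) s) /\
  (forall X t, X \notin derived_algebra mu -> jordan_sizes (ad mu X) t ->
     (t <= s :> seqlexi nat)%O).

Definition in_family_F (p : nat) (mu : structure_constants K (3 * p + 1)) :
    Prop :=
  three_step_nilpotent mu /\ characteristic_sequence mu (rcons (nseq p 3%N) 1%N).

End JordanBlocks.

(* Main.v *)
From HB Require Import structures.
Require Import Defs.
From mathcomp Require Import all_boot all_order all_algebra.
From mathcomp Require Import mpoly zify ring.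
Set Implicit Arguments.
Unset Strict Implicit.
Unset Printing Implicit Defensive.
Import GRing.Theory.
Local Open Scope ring_scope.

(** Let X be a vector whose adjoint has p Jordan blocks of size 3. It yields a
    basis X, Y_i, Z_i = [X, Y_i], W_i = [X, Z_i] with C^2(g) = span(W). Change
    the brackets [Y_i, Y_j] by an arbitrary alternating form with values in
    C^2(g), and the brackets [Y_i, Z_j] by a symmetric form s(Y_i, Y_j) with
    values in C^2(g) subject to the C(p, 3) equations s(y, a(y', y'')) + cyclic = 0,
    where a is the Z-component of [Y, Y]. The result stays in 3Nilp, and X still
    maps Y_i to Z_i and Z_i to W_i. This linear family has dimension at least
    p (C(p, 2) + max(0, p^2 - C(p, 2) - C(p, 3))). A member isomorphic to g is a
    polynomial function of the images of X, Y_i modulo C^2(g) and of one inverse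
    determinant, hence of (p + 1)(2p + 1) + 1 parameters, fewer than the
    dimension when p >= 4. A polynomial map into a space of larger dimension is
    not dominant, whereas an open orbit would contain the generic members of the
    family. *)

(** * Nonvanishing of polynomials and algebraic dependence *)

(** Reduction modulo [B] isolates the lowest digit, and division by [B] leaves the others to the
    induction. This makes the exponents of a Kronecker substitution determine the monomial. *)
Lemma base_digits_inj (B n : nat) (f g : 'I_n -> nat) :
  (forall i, f i < B)%N -> (forall i, g i < B)%N ->
  (\sum_(i < n) f i * B ^ i = \sum_(i < n) g i * B ^ i)%N -> f =1 g.
Proof.
elim: n f g => [|n IHn] f g fB gB; first by move=> _ [].
have shift (h : 'I_n.+1 -> nat) : (\sum_(i < n.+1) h i * B ^ i =
    (\sum_(i < n) h (lift ord0 i) * B ^ i) * B + h ord0)%N.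
  rewrite big_ord_recl expn0 muln1 addnC big_distrl /=; congr (_ + _)%N.
  by apply: eq_bigr => i _; rewrite /bump /= add1n expnSr mulnA.
rewrite !shift => E; have B_gt0 : (0 < B)%N := leq_ltn_trans (leq0n _) (fB ord0).
have E0 : f ord0 = g ord0.
  by move/(congr1 (modn^~ B)): E; rewrite /= !modnMDl !modn_small.
have E1 := congr1 (divn^~ B) E; rewrite /= !divnMDl // !divn_small // !addn0 in E1.
move=> i; case: (unliftP ord0 i) => [j|] -> //.
exact: (IHn (fun j => f (lift ord0 j)) (fun j => g (lift ord0 j))).
Qed.

Lemma mpoly_nonzero_eval (K : fieldType) (charK0 : [pchar K] =i pred0) n
    (P : {mpoly K[n]}) : P != 0 -> exists v, P.@[v] != 0.
Proof.
(* Kronecker substitution X_i := t ^ (B ^ i), B exceeding all exponents. *)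
move=> P0; pose B := msize P.
pose code (m : 'X_{1..n}) := (\sum_(i < n) m i * B ^ i)%N.
pose q : {poly K} := \sum_(m <- msupp P) P@_m *: 'X^(code m).
have q_eval t : q.[t] = P.@[fun i => t ^+ (B ^ i)].
  rewrite mevalE horner_sum; apply: eq_bigr => m _.
  rewrite hornerZ hornerXn -prodrXr; congr (_ * _).
  by apply: eq_bigr => i _; rewrite mulnC exprM.
have q0 : q != 0.
  (* All exponents in [P] are below [B], so [code] is injective on the support, and the leading
     coefficient of [P] survives as a coefficient of [q]. *)
  have mP : mlead P \in msupp P by rewrite mlead_supp.
  apply/eqP => /(congr1 (fun r : {poly K} => r`_(code (mlead P)))).
  rewrite coef_sum coef0 (bigD1_seq (mlead P)) ?msupp_uniq //=.
  rewrite coefZ coefXn eqxx mulr1 big_seq_cond big1 ?addr0 => [/eqP|m].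
    by rewrite mleadc_eq0 (negPf P0).
  case/andP=> mS m_neq; rewrite coefZ coefXn.
  case: eqP => [E|]; last by rewrite mulr0.
  have ltB (m' : 'X_{1..n}) i : m' \in msupp P -> (m' i < B)%N.
    move/msize_mdeg_lt; apply: leq_ltn_trans.
    by rewrite mdegE (bigD1 i) //= leq_addr.
  case/eqP: m_neq; apply/mnmP => i.
  exact/esym/(base_digits_inj (fun i => ltB _ i mP) (fun i => ltB _ i mS) E).
(* In characteristic 0 these [size q] integers are distinct, one more than the degree of [q], so
   they cannot all be roots. *)
pose rs := [seq (i%:R : K) | i <- iota 0 (size q)].
have rs_uniq : uniq rs.
  rewrite map_inj_in_uniq ?iota_uniq // => i j _ _ /eqP E.
  wlog le_ij : i j E / (i <= j)%N.
    by move=> W; case/orP: (leq_total i j) => H; [|symmetry]; apply: W;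
       rewrite // eq_sym.
  apply/eqP; rewrite eqn_leq le_ij /= -subn_eq0; move: E.
  rewrite eq_sym -subr_eq0 -natrB // => E.
  have /pcharf0P P0' := charK0; by rewrite P0' in E.
have : ~~ all (root q) rs.
  apply/negP => /(max_poly_roots q0) /(_ rs_uniq).
  by rewrite size_map size_iota ltnn.
case/allPn => t _ t_root; exists (fun i => t ^+ (B ^ i)).
by rewrite -q_eval.
Qed.

Lemma card_bmultinom n b : (#|{: 'X_{1..n < b}}| <= b ^ n)%N.
Proof.
have lt (m : 'X_{1..n < b}) i : (m i < b)%N.
  by apply: leq_ltn_trans (bmdeg m); rewrite mdegE (bigD1 i) //= leq_addr.
pose f (m : 'X_{1..n < b}) := [ffun i => Ordinal (lt m i)].
suff /leq_card : injective f by rewrite card_ffun !card_ord.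
move=> m1 m2 /ffunP E; apply/val_inj/mnmP => i.
by have := E i; rewrite !ffunE => /(congr1 val).
Qed.

Lemma msizeM_pred (R : idomainType) n (p q : {mpoly R[n]}) :
  (msize (p * q) <= (msize p + msize q).-1)%N.
Proof.
have [->|p0] := eqVneq p 0; first by rewrite mul0r msize0.
have [->|q0] := eqVneq q 0; first by rewrite mulr0 msize0.
by rewrite msizeM.
Qed.

(* For large d the d ^ N monomials of partial degrees < d in the P i
   outnumber the monomials in M variables that can occur in them. *)
Lemma mpoly_alg_dependent (K : fieldType) M N (P : 'I_N -> {mpoly K[M]}) :
  (M < N)%N ->
  exists2 Q : {mpoly K[N]}, Q != 0 & Q \mPo [tuple P i | i < N] = 0.
Proof.
move=> ltMN; pose D := \max_i msize (P i).
(* The products [im al] have size at most N (d - 1) D + 1 <= C d = b, hence involve at most b^M =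
   C^M d^M monomials. The choice d > C^M makes this less than d^(M + 1) <= d^N. *)
pose C := (N * D).+1; pose d := (C ^ M).+1; pose b := (C * d)%N.
pose I := {ffun 'I_N -> 'I_d}; pose J := {: 'X_{1..M < b}}.
have lt_card : (#|J| < #|{: I}|)%N.
  rewrite card_ffun !card_ord (leq_ltn_trans (card_bmultinom _ _)) // /b expnMn.
  apply: leq_trans (_ : d ^ M.+1 <= _)%N; last by rewrite leq_pexp2l.
  by rewrite expnS ltn_pmul2r ?expn_gt0.
pose mon (al : I) : 'X_{1..N} := [multinom (al i : nat) | i < N].
pose im (al : I) := \prod_(i < N) P i ^+ al i.
have msz_pow (p : {mpoly K[M]}) k : (msize p <= D -> msize (p ^+ k) <= (k * D).+1)%N.
  move=> leD; elim: k => [|k IHk]; first by rewrite expr0 msize1.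
  rewrite exprS (leq_trans (msizeM_pred _ _)) //.
  rewrite mulSn; move: leD IHk; set s := msize (p ^+ k); set t := msize p; lia.
have msz_im al : (msize (im al) <= b)%N.
  suff S (r : seq 'I_N) : (msize (\prod_(i <- r) P i ^+ al i)
      <= (\sum_(i <- r) al i * D).+1)%N.
    apply: leq_trans (S _) _.
    apply: (@leq_trans (\sum_(i < N) d.-1 * D).+1)%N; last first.
      have : (0 < d)%N by [].
      rewrite sum_nat_const card_ord /b /C.
      by case: (d) => // z _; rewrite succnK mulnCA; move: (N * D)%N => y; nia.
    by rewrite ltnS; apply: leq_sum => i _; rewrite leq_mul2r -ltnS ltn_ord orbT.
  elim: r => [|i r IHr]; first by rewrite !big_nil msize1.
  rewrite !big_cons (leq_trans (msizeM_pred _ _)) //.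
  have := msz_pow (P i) (al i) (leq_bigmax i); move: IHr.
  set s := msize _; set t := msize _; lia.
pose A : 'M[K]_(#|{: I}|, #|J|) :=
  \matrix_(a, c) (im (enum_val a))@_(enum_val c : 'X_{1..M < b}).
(* [A] has more rows than columns, so its rows are dependent; [u] gives the coefficients of the
   relation [Q]. *)
have [u u_ker u0] : exists2 u : 'rV_#|{: I}|, u *m A = 0 & u != 0.
  have : kermx A != 0.
    rewrite kermx_eq0 -row_leq_rank -ltnNge.
    exact: leq_ltn_trans (rank_leq_col _) lt_card.
  by case/rowV0Pn => u /sub_kermxP uA u0; exists u.
have mon_inj : injective mon.
  move=> al be /mnmP E; apply/ffunP => i; apply/val_inj.
  by have := E i; rewrite !mnmE.
exists (\sum_al u 0 (enum_rank al) *: 'X_[mon al]).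
  apply: contraNneq u0 => Q0; apply/eqP/rowP => a; rewrite mxE.
  have := congr1 (mcoeff (mon (enum_val a))) Q0.
  rewrite mcoeff0 raddf_sum (bigD1 (enum_val a)) //= big1 ?addr0.
    by rewrite mcoeffZ mcoeffX eqxx mulr1 enum_valK.
  by move=> be ne; rewrite mcoeffZ mcoeffX (inj_eq mon_inj) (negPf ne) mulr0.
rewrite (raddf_sum (comp_mpoly _)) /=; apply/mpolyP => m; rewrite mcoeff0.
(* Coefficients of degree at least [b] vanish by the size bound, the others by [u *m A = 0]. *)
have [lt_mb|ge_mb] := ltnP (mdeg m) b; last first.
  rewrite raddf_sum big1 // => al _; rewrite comp_mpolyZ comp_mpolyX /= mcoeffZ.
  rewrite (eq_bigr (fun i => P i ^+ al i)); last first.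
    by move=> i _; rewrite tnth_mktuple mnmE.
  apply/eqP; rewrite mulf_eq0 mcoeff_eq0 msize_mdeg_ge ?orbT //.
  exact: leq_trans (msz_im al) ge_mb.
have := congr1 (fun v : 'rV_#|J| => v 0 (enum_rank (BMultinom lt_mb))) u_ker.
rewrite !mxE (reindex enum_rank) /=; last exact/onW_bij/enum_rank_bij.
move=> <-; rewrite raddf_sum; apply: eq_bigr => al _.
rewrite mxE !enum_rankK comp_mpolyZ comp_mpolyX /= mcoeffZ; congr (_ * mcoeff _ _).
by apply: eq_bigr => i _; rewrite tnth_mktuple mnmE.
Qed.

(** * Functions given by polynomials *)

Definition polyfun (K : fieldType) (I : finType) (g : (I -> K) -> K) :=
  exists P : {mpoly K[#|I|]}, forall x, g x = P.@[fun a => x (enum_val a)].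

Section PolynomialFunctions.

Variables (K : fieldType) (I : finType).
Implicit Types f g : (I -> K) -> K.

Lemma eq_polyfun f g : f =1 g -> polyfun g -> polyfun f.
Proof. by move=> fg [P gP]; exists P => x; rewrite fg. Qed.

Lemma polyfun_const c : polyfun (fun _ : I -> K => c).
Proof. by exists c%:MP => x; rewrite mevalC. Qed.

Lemma polyfun_var i : polyfun (fun x : I -> K => x i).
Proof. by exists 'X_(enum_rank i) => x; rewrite mevalXU enum_rankK. Qed.

Lemma polyfunD f g : polyfun f -> polyfun g -> polyfun (fun x => f x + g x).
Proof. by move=> [P fP] [Q gQ]; exists (P + Q) => x; rewrite mevalD fP gQ. Qed.

Lemma polyfunM f g : polyfun f -> polyfun g -> polyfun (fun x => f x * g x).
Proof. by move=> [P fP] [Q gQ]; exists (P * Q) => x; rewrite mevalM fP gQ. Qed.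

Lemma polyfun_sum (J : Type) (r : seq J) (Q : pred J) (F : J -> (I -> K) -> K) :
  (forall j, polyfun (F j)) -> polyfun (fun x => \sum_(j <- r | Q j) F j x).
Proof.
move=> FP; elim: r => [|j r IHr].
  by apply: eq_polyfun (polyfun_const 0) => x; rewrite big_nil.
apply: (@eq_polyfun _ (fun x => (Q j)%:R * F j x + \sum_(j <- r | Q j) F j x)).
  by move=> x; rewrite big_cons; case: ifP; rewrite ?mul1r ?mul0r ?add0r.
by apply: polyfunD => //; apply: polyfunM => //; apply: polyfun_const.
Qed.

Lemma polyfun_prod (J : Type) (r : seq J) (F : J -> (I -> K) -> K) :
  (forall j, polyfun (F j)) -> polyfun (fun x => \prod_(j <- r) F j x).
Proof.
move=> FP; elim: r => [|j r IHr].
  by apply: eq_polyfun (polyfun_const 1) => x; rewrite big_nil.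
apply: (@eq_polyfun _ (fun x => F j x * \prod_(j <- r) F j x)); last exact: polyfunM.
by move=> x; rewrite big_cons.
Qed.

Lemma polyfun_det n (A : (I -> K) -> 'M[K]_n) :
  (forall i j, polyfun (fun x => A x i j)) -> polyfun (fun x => \det (A x)).
Proof.
move=> AP; apply: polyfun_sum => s; apply: polyfunM; first exact: polyfun_const.
by apply: polyfun_prod.
Qed.

Lemma polyfun_adj n (A : (I -> K) -> 'M[K]_n) i j :
  (forall i j, polyfun (fun x => A x i j)) -> polyfun (fun x => (\adj (A x)) i j).
Proof.
move=> AP; apply: (@eq_polyfun _ (fun x => cofactor (A x) j i)).
  by move=> x; rewrite mxE.
apply: polyfunM; first exact: polyfun_const.
apply: polyfun_det => k l; apply: eq_polyfun (AP (lift j k) (lift i l)) => x.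
by rewrite !mxE.
Qed.

Lemma polyfun_mulmx m n q (A : (I -> K) -> 'M[K]_(m, n))
    (B : (I -> K) -> 'M[K]_(n, q)) i j :
  (forall i j, polyfun (fun x => A x i j)) ->
  (forall i j, polyfun (fun x => B x i j)) ->
  polyfun (fun x => (A x *m B x) i j).
Proof.
move=> AP BP.
apply: (@eq_polyfun _ (fun x => \sum_k A x i k * B x k j)).
  by move=> x; rewrite mxE.
by apply: polyfun_sum => k; apply: polyfunM.
Qed.

End PolynomialFunctions.

Lemma polyfun_meval (K : fieldType) (I : finType) n (F : (I -> K) -> 'I_n -> K)
    (P : {mpoly K[n]}) :
  (forall a, polyfun (fun x => F x a)) -> polyfun (fun x => P.@[F x]).
Proof.
move=> FP; apply: (@eq_polyfun _ _ _
  (fun x => \sum_(m <- msupp P) P@_m * \prod_i \prod_(j < m i) F x i)).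
  move=> x; rewrite mevalE; apply: eq_bigr => m _; congr (_ * _).
  by apply: eq_bigr => i _; rewrite prodr_const card_ord.
apply: polyfun_sum => m; apply: polyfunM; first exact: polyfun_const.
by apply: polyfun_prod => i; apply: polyfun_prod.
Qed.

(** The components of [g] outnumber its variables, so they satisfy a nonzero relation [Q]. A point
    where neither [h] nor [Q] vanishes cannot be a value of [g]. *)
Lemma polyfun_not_dominant (K : fieldType) (charK0 : [pchar K] =i pred0)
    (I J : finType) (g : (I -> K) -> J -> K) (h : (J -> K) -> K) (e0 : J -> K) :
  (#|I| < #|J|)%N -> (forall j, polyfun (fun x => g x j)) ->
  polyfun h -> h e0 != 0 ->
  exists2 e, h e != 0 & forall x, ~ g x =1 e.
Proof.
move=> ltIJ gP [R hR] h0.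
have /fin_all_exists [P PP] : forall a : 'I_#|J|, exists P : {mpoly K[#|I|]},
    forall x, g x (enum_val a) = P.@[fun a => x (enum_val a)].
  by move=> a; case: (gP (enum_val a)) => P PP; exists P.
have [Q Q0 QP] := mpoly_alg_dependent P ltIJ.
have [|v] := mpoly_nonzero_eval charK0 (P := R * Q).
  rewrite mulf_neq0 //; apply: contraNneq h0 => R0.
  by rewrite hR R0 meval0.
rewrite mevalM mulf_eq0 negb_or => /andP[Rv Qv].
exists (fun j => v (enum_rank j)).
  rewrite hR; apply: contraNneq Rv => <-; apply/eqP/meval_eq => a.
  by rewrite enum_valK.
move=> x gx; case/eqP: Qv.
have := congr1 (meval (fun a => x (enum_val a))) QP.
rewrite meval0 comp_mpoly_meval => <-; apply: meval_eq => a.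
by rewrite tnth_mktuple -PP gx enum_valK.
Qed.

(** * Bilinearity of brackets and perturbation by cocycles *)

Section BracketTheory.

Variables (K : fieldType) (n : nat).
Implicit Types (mu : structure_constants K n) (X Y Z : 'rV[K]_n).

Lemma bracket_linear_l mu Y : linear (fun X => bracket mu X Y).
Proof.
move=> a U V; apply/rowP => k; rewrite !mxE mulr_sumr -big_split /=.
apply: eq_bigr => i _; rewrite mulr_sumr -big_split /=; apply: eq_bigr => j _.
by rewrite !mxE; ring.
Qed.

Lemma bracket_linear_r mu X : linear (bracket mu X).
Proof.
move=> a U V; apply/rowP => k; rewrite !mxE mulr_sumr -big_split /=.
apply: eq_bigr => i _; rewrite mulr_sumr -big_split /=; apply: eq_bigr => j _.
by rewrite !mxE; ring.
Qed.

HB.instance Definition _ mu X :=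
  GRing.isLinear.Build K 'rV[K]_n 'rV[K]_n *:%R (bracket mu X)
    (bracket_linear_r mu X).

(** Swapping the arguments lets linearity in the first one be declared as a canonical instance. *)
Definition bracket_r mu Y X := bracket mu X Y.

HB.instance Definition _ mu Y :=
  GRing.isLinear.Build K 'rV[K]_n 'rV[K]_n *:%R (bracket_r mu Y)
    (bracket_linear_l mu Y).

Lemma bracketDl mu X X' Y : bracket mu (X + X') Y = bracket mu X Y + bracket mu X' Y.
Proof. exact: (linearD (bracket_r mu Y)). Qed.

Lemma bracketZl mu a X Y : bracket mu (a *: X) Y = a *: bracket mu X Y.
Proof. exact: (linearZ_LR (bracket_r mu Y)). Qed.

Lemma bracketDr mu X Y Y' : bracket mu X (Y + Y') = bracket mu X Y + bracket mu X Y'.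
Proof. exact: linearD. Qed.

Lemma bracketZr mu a X Y : bracket mu X (a *: Y) = a *: bracket mu X Y.
Proof. exact: linearZ_LR. Qed.

Lemma bracket_suml mu Y (I : Type) (r : seq I) (P : pred I) F :
  bracket mu (\sum_(i <- r | P i) F i) Y = \sum_(i <- r | P i) bracket mu (F i) Y.
Proof. exact: (linear_sum (bracket_r mu Y)). Qed.

Lemma bracket_antisym mu X Y : in_3Nilp mu -> bracket mu X Y = - bracket mu Y X.
Proof.
case=> [[alt _] _]; have := alt (X + Y).
rewrite bracketDr !bracketDl !alt add0r addr0 => /eqP.
by rewrite addr_eq0 => /eqP ->; rewrite opprK.
Qed.

Lemma bracket_span mu U V :
  bracket mu U V =
    \sum_i \sum_j (U 0 i * V 0 j) *: bracket mu (delta_mx 0 i) (delta_mx 0 j).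
Proof.
rewrite {1}[U]row_sum_delta bracket_suml; apply: eq_bigr => i _.
rewrite bracketZl {1}[V]row_sum_delta linear_sum scaler_sumr /=.
by apply: eq_bigr => j _; rewrite linearZ /= scalerA.
Qed.

Lemma bracket_derived mu U V : bracket mu U V \in derived_algebra mu.
Proof.
rewrite bracket_span; apply: rpred_sum => i _; apply: rpred_sum => j _.
apply/rpredZ/memv_span/mapP; exists (i, j) => //.
by rewrite mem_enum.
Qed.

Definition sc_of (be : 'rV[K]_n -> 'rV[K]_n -> 'rV[K]_n) :
    structure_constants K n :=
  [ffun ijk => be (delta_mx 0 ijk.1.1) (delta_mx 0 ijk.1.2) 0 ijk.2].

Lemma linear_row_sum m (f : 'rV[K]_m -> 'rV[K]_n) (X : 'rV[K]_m) :
  linear f -> f X = \sum_i X 0 i *: f (delta_mx 0 i).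
Proof.
move=> lin_f; pose g : {linear 'rV[K]_m -> 'rV[K]_n} :=
  HB.pack f (GRing.isLinear.Build K _ _ *:%R f lin_f).
rewrite -[f]/(g : _ -> _) {1}[X]row_sum_delta linear_sum.
by apply: eq_bigr => i _; rewrite linearZ.
Qed.

Lemma bracket_sc_of be X Y :
  (forall Y, linear (fun X => be X Y)) -> (forall X, linear (be X)) ->
  bracket (sc_of be) X Y = be X Y.
Proof.
move=> lin_l lin_r; rewrite (linear_row_sum X (lin_l Y)).
apply/rowP => k; rewrite mxE summxE; apply: eq_bigr => i _.
rewrite (linear_row_sum Y (lin_r _)) mxE summxE mulr_sumr.
by apply: eq_bigr => j _; rewrite !mxE ffunE mulrA.
Qed.

(** The values of [psi] are central for both [mu] and [psi], so a double bracket of the sum is that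
    of [mu] plus [psi (bracket mu X Y) Z]. The Jacobi identity then splits into that of [mu] and the
    cocycle condition, and triple brackets vanish because [psi] kills double brackets of [mu]. *)
Lemma in_3Nilp_perturb mu (psi : 'rV[K]_n -> 'rV[K]_n -> 'rV[K]_n) :
  in_3Nilp mu ->
  (forall Y, linear (fun X => psi X Y)) -> (forall X, linear (psi X)) ->
  (forall X, psi X X = 0) ->
  (forall X Y Z, psi (bracket mu X Y) Z + psi (bracket mu Y Z) X
                 + psi (bracket mu Z X) Y = 0) ->
  (forall X Y Z, psi (psi X Y) Z = 0) ->
  (forall X Y Z, bracket mu (psi X Y) Z = 0) ->
  (forall X Y Z T, psi (bracket mu (bracket mu X Y) Z) T = 0) ->
  in_3Nilp (sc_of (fun X Y => bracket mu X Y + psi X Y)).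
Proof.
move=> [[alt jac] nil] lin_l lin_r psi_alt psi_jac psi_psi mu_psi psi_mu.
set be := fun X Y => _.
have be_l Y : linear (fun X => be X Y).
  by move=> a U V; rewrite /be bracket_linear_l lin_l scalerDr addrACA.
have be_r X : linear (be X).
  by move=> a U V; rewrite /be bracket_linear_r lin_r scalerDr addrACA.
have psiDl X X' Y : psi (X + X') Y = psi X Y + psi X' Y.
  by have := lin_l Y 1 X X'; rewrite !scale1r.
have E X Y : bracket (sc_of be) X Y = bracket mu X Y + psi X Y.
  exact: bracket_sc_of.
have E2 X Y Z : bracket (sc_of be) (bracket (sc_of be) X Y) Z =
    bracket mu (bracket mu X Y) Z + psi (bracket mu X Y) Z.
  by rewrite !E bracketDl mu_psi addr0 psiDl psi_psi addr0.
split; [split|] => [X|X Y Z|X Y Z T].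
- by rewrite E alt psi_alt addr0.
- rewrite !E2 [X in X + _]addrACA [LHS]addrACA psi_jac addr0; exact: jac.
- by rewrite (E2 X Y Z) E bracketDl nil mu_psi psiDl psi_mu psi_psi !addr0.
Qed.

End BracketTheory.

(** * Bilinear and trilinear forms on K^p, and the dimension count *)

(** Rotations and the swap of the first two indices generate all permutations. Distinct indices thus
    reduce, up to sign, to an increasing triple, and a repeated index to the diagonal case. *)
Lemma alternating_trilinear_sorted (K : fieldType) p
    (T : 'I_p -> 'I_p -> 'I_p -> K) :
  (forall i j k, T i j k = T j k i) -> (forall i j k, T j i k = - T i j k) ->
  (forall i k, T i i k = 0) ->
  (forall i j k : 'I_p, (i < j < k)%N -> T i j k = 0) ->
  forall i j k, T i j k = 0.
Proof.
move=> cyc anti diag srt.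
have rot i j k : T i j k = T k i j by rewrite [RHS]cyc.
have lt_ij (i j k : 'I_p) : (i < j)%N -> T i j k = 0.
  move=> ij; case: (ltngtP j k) => [jk|kj|/val_inj <-].
  - by apply: srt; rewrite ij.
  - case: (ltngtP i k) => [ik|ki|/val_inj <-].
    + by rewrite rot anti srt ?oppr0 // ik.
    + by rewrite rot srt // ki.
    + by rewrite rot diag.
  - by rewrite cyc diag.
move=> i j k; case: (ltngtP i j) => [/lt_ij ->|ji|/val_inj <-] //.
by rewrite anti lt_ij ?oppr0.
Qed.

Definition bform (K : fieldType) p (S : 'M[K]_p) (y z : 'rV[K]_p) : K :=
  (y *m S *m z^T) 0 0.

Lemma bformDl (K : fieldType) p (S : 'M[K]_p) y y' z :
  bform S (y + y') z = bform S y z + bform S y' z.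
Proof. by rewrite /bform !mulmxDl mxE. Qed.

Lemma bformZl (K : fieldType) p (S : 'M[K]_p) c y z :
  bform S (c *: y) z = c * bform S y z.
Proof. by rewrite /bform -!scalemxAl mxE. Qed.

Lemma bformDr (K : fieldType) p (S : 'M[K]_p) y z z' :
  bform S y (z + z') = bform S y z + bform S y z'.
Proof. by rewrite /bform linearD mulmxDr mxE. Qed.

Lemma bformZr (K : fieldType) p (S : 'M[K]_p) c y z :
  bform S y (c *: z) = c * bform S y z.
Proof. by rewrite /bform linearZ -scalemxAr mxE. Qed.

Lemma bform_tr (K : fieldType) p (S : 'M[K]_p) y z :
  bform S^T y z = bform S z y.
Proof.
rewrite /bform; have -> : y *m S^T *m z^T = (z *m S *m y^T)^T.
  by rewrite !trmx_mul trmxK mulmxA.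
by rewrite mxE.
Qed.

Lemma bform_delta (K : fieldType) p (S : 'M[K]_p) i j :
  bform S (delta_mx 0 i) (delta_mx 0 j) = S i j.
Proof. by rewrite /bform -rowE trmx_delta -colE !mxE. Qed.

Lemma linear_eq0 (K : fieldType) p (f : 'rV[K]_p -> K) :
  (forall u v, f (u + v) = f u + f v) -> (forall a u, f (a *: u) = a * f u) ->
  (forall i, f (delta_mx 0 i) = 0) -> forall u, f u = 0.
Proof.
move=> fD fZ f0 u; have f00 : f 0 = 0 by rewrite -(scale0r (0 : 'rV_p)) fZ mul0r.
rewrite [u]row_sum_delta; elim/big_rec: _ => // i v _ fv.
by rewrite fD fZ f0 mulr0 add0r.
Qed.

Lemma trilinear_eq0 (K : fieldType) p (f : 'rV[K]_p -> 'rV[K]_p -> 'rV[K]_p -> K) :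
  (forall x y z, f x y z = f y z x) ->
  (forall x x' y z, f (x + x') y z = f x y z + f x' y z) ->
  (forall a x y z, f (a *: x) y z = a * f x y z) ->
  (forall i j k, f (delta_mx 0 i) (delta_mx 0 j) (delta_mx 0 k) = 0) ->
  forall x y z, f x y z = 0.
Proof.
move=> cyc fD fZ f0 x y z.
apply: (linear_eq0 (f := fun x => f x y z)) => // i.
rewrite cyc; apply: (linear_eq0 (f := fun y => f y z _)) => // j.
rewrite cyc; apply: (linear_eq0 (f := fun z => f z _ _)) => //.
Qed.

(** Index sets of the symmetry equations and of the cyclic equations; [incr_pair] also indexes a
    basis of the alternating forms. *)
Definition incr_pair p := {w : 'I_p * 'I_p | (w.1 < w.2)%N}.
Definition incr_triple p := {t : 'I_p * 'I_p * 'I_p | (t.1.1 < t.1.2 < t.2)%N}.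


Lemma card_incr_pair p : #|{: incr_pair p}| = 'C(p, 2).
Proof.
rewrite card_sub -(card_ltn_sorted_tuples 2 p) -!sum1_card.
rewrite [RHS](reindex (fun w : 'I_p * 'I_p => [tuple w.1; w.2])) /=.
  by apply: eq_bigl => w; rewrite !inE /=; case: ltnP.
exists (fun t : 2.-tuple 'I_p => (tnth t ord0, tnth t ord_max)) => [[]|t] //= _.
by case/tupleP: t => x t; case/tupleP: t => y t; rewrite (tuple0 t); apply: val_inj.
Qed.

Lemma card_incr_triple p : #|{: incr_triple p}| = 'C(p, 3).
Proof.
rewrite card_sub -(card_ltn_sorted_tuples 3 p) -!sum1_card.
rewrite [RHS](reindex (fun w : 'I_p * 'I_p * 'I_p => [tuple w.1.1; w.1.2; w.2])) /=.
  by apply: eq_bigl => w; rewrite !inE /=; case: (w.1.1 < w.1.2)%N; case: (w.1.2 < w.2)%N.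
exists (fun t : 3.-tuple 'I_p =>
  (tnth t ord0, tnth t (Ordinal (isT : 1 < 3)%N), tnth t ord_max)) => [[[]]|t] //= _.
case/tupleP: t => x t; case/tupleP: t => y t; case/tupleP: t => z t.
by rewrite (tuple0 t); apply: val_inj.
Qed.

(* The [#|incr_pair p| + #|incr_triple p|] linear conditions on an arbitrary matrix
   express symmetry and the cyclic identity. *)
Lemma symmetric_cocycles (K : fieldType) p (a : 'rV[K]_p -> 'rV[K]_p -> 'rV[K]_p) :
  (forall y z, a z y = - a y z) -> (forall y, a y y = 0) ->
  (forall x y z, a (x + y) z = a x z + a y z) ->
  (forall c x y, a (c *: x) y = c *: a x y) ->
  exists r : nat, exists S L : 'I_r -> 'M[K]_p,
  [/\ (p * p - ('C(p, 2) + 'C(p, 3)) <= r)%N,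
      forall l, (S l)^T = S l,
      forall l x y z, bform (S l) z (a x y) + bform (S l) x (a y z)
                      + bform (S l) y (a z x) = 0 &
      forall l m, \sum_i \sum_j L l i j * S m i j = (l == m)%:R].
Proof.
move=> a_anti a_alt aD aZ.
pose e i : 'rV[K]_p := delta_mx 0 i.
pose J (S : 'M[K]_p) x y z :=
  bform S z (a x y) + bform S x (a y z) + bform S y (a z x).
pose eqs (S : 'M[K]_p) (q : incr_pair p + incr_triple p) : K := match q with
  | inl w => S (val w).1 (val w).2 - S (val w).2 (val w).1
  | inr t => J S (e (val t).1.1) (e (val t).1.2) (e (val t).2)
  end.
pose eqs_mx (v : 'rV[K]_(p * p)) : 'rV_#|{: incr_pair p + incr_triple p}| :=
  \row_q eqs (vec_mx v) (enum_val q).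
have eqs_lin : linear eqs_mx.
  move=> c u v; apply/rowP => q; rewrite !mxE /eqs linearP /=.
  case: (enum_val q) => [w|t]; first by rewrite !mxE; ring.
  rewrite /J /bform !mulmxDr !mulmxDl -!scalemxAr -!scalemxAl !mxE; ring.
pose E := HB.pack_for {linear 'rV[K]_(p * p) -> 'rV_#|{: incr_pair p + incr_triple p}|}
  eqs_mx (GRing.isLinear.Build K _ _ *:%R eqs_mx eqs_lin).
(* The rows of [k] are a basis of the solution space, whose dimension is at least p^2 minus the
   number of equations. The columns of [pinvmx k] give the dual coordinates [L]. *)
pose A := lin1_mx E; pose k := row_base (kermx A).
exists (\rank (kermx A)).
pose S l := vec_mx (row l k); pose L l := vec_mx (row l (pinvmx k)^T).
have S_eqs l q : eqs (S l) q = 0.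
  have : row l k *m A = 0.
    by apply/sub_kermxP; rewrite (submx_trans (row_sub _ _)) ?eq_row_base.
  rewrite mul_rV_lin1 => /rowP /(_ (enum_rank q)).
  by rewrite !mxE enum_rankK.
have S_sym l i j : S l i j = S l j i.
  wlog lt_ij : i j / (i < j)%N.
    move=> W; case: (ltngtP i j) => [/W //|/W //|/val_inj -> //].
  by apply/eqP; rewrite -subr_eq0; apply/eqP/(S_eqs l (inl (Sub (i, j) lt_ij))).
exists S, L; split=> [|l|l|l m].
- rewrite mxrank_ker leq_sub2l // (leq_trans (rank_leq_col _)) //.
  by rewrite card_sum card_incr_pair card_incr_triple.
- by apply/matrixP => i j; rewrite mxE S_sym.
(* The cyclic sum is trilinear, and alternating because [a] is, so the equations on increasing basis
   triples suffice. *)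
- apply: (trilinear_eq0 (f := J (S l))) => [x y z|x x' y z|c x y z|].
  + by rewrite /J [RHS]addrC addrA.
  + rewrite /J (a_anti (x + x')) !aD opprD -!a_anti bformDl !bformDr; ring.
  + rewrite /J (a_anti (c *: x)) !aZ -scalerN -a_anti bformZl !bformZr; ring.
  apply: alternating_trilinear_sorted => [i j m|i j m|i m|i j m ijm].
  + by rewrite /J [RHS]addrC addrA.
  + rewrite /J (a_anti (e i) (e j)) (a_anti (e m) (e i)) (a_anti (e j) (e m)).
    rewrite -!(scaleN1r (a _ _)) !bformZr; ring.
  + rewrite /J a_alt (a_anti (e i) (e m)) -scaleN1r bformZr.
    rewrite -[0 : 'rV_p](scale0r (0 : 'rV_p)) bformZr; ring.
  + exact: (S_eqs l (inr (Sub (i, j, m) ijm))).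
have : (k *m pinvmx k) m l = (m == l)%:R by rewrite mulmxVp ?row_base_free // mxE.
rewrite eq_sym => <-; rewrite mxE (reindex _ (curry_mxvec_bij p p)) /=.
rewrite pair_big /=; apply: eq_bigr => -[i j] _ /=.
by rewrite mulrC /S /L !mxE.
Qed.

Lemma alternating_forms (K : fieldType) p :
  exists S L : incr_pair p -> 'M[K]_p,
  [/\ forall l y, bform (S l) y y = 0 &
      forall l m, \sum_i \sum_j L l i j * S m i j = (l == m)%:R].
Proof.
exists (fun w => delta_mx (val w).1 (val w).2 - delta_mx (val w).2 (val w).1).
exists (fun w => delta_mx (val w).1 (val w).2); split=> [w y|w w'].
  have E i j : (y *m delta_mx i j *m y^T) 0 0 = y 0 i * y 0 j.
    by rewrite -(mul_delta_mx (0 : 'I_1)) mulmxA -colE -mulmxA -rowE mxE big_ord1 !mxE.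
  by rewrite /bform mulmxBr mulmxBl [LHS]mxE E mxE E mulrC subrr.
case: w w' => -[i j] /= ij [[i' j'] /= ij'].
rewrite (bigD1 i) //= (bigD1 j) //= !big1 ?addr0; last 2 first.
- by move=> i1 ne; rewrite big1 // => j1 _; rewrite mxE (negPf ne) mul0r.
- by move=> j1 ne; rewrite mxE (negPf ne) andbF mul0r.
rewrite -(inj_eq val_inj (Sub (i, j) ij)) xpair_eqE !mxE !eqxx mul1r.
(* Both pairs are increasing, so neither is the reversal of the other. *)
have -> : (i == j') && (j == i') = false.
  by apply/negP => /andP[/eqP E1 /eqP E2]; move: ij ij'; rewrite E1 E2; lia.
by rewrite subr0.
Qed.

(** From p = 7 on, the alternating part p C(p, 2) alone is large enough. For p = 4, 5, 6 the
    symmetric forms enter, giving 46 < 48, 67 < 75 and 92 < 96. *)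
Lemma dimension_count p : (4 <= p)%N ->
  ((p.+1 * (p + p).+1).+1 < ('C(p, 2) + (p * p - ('C(p, 2) + 'C(p, 3)))) * p)%N.
Proof.
move=> p4; case: (leqP 7 p) => [p7|]; last by move: p p4; do 7![case=> //].
apply: (@leq_trans ('C(p, 2) * p)); last by rewrite leq_mul2r leq_addr orbT.
have := bin2 p; have := odd_double_half (p * p.-1).
have -> : odd (p * p.-1) = false by case: (p) => // q; rewrite oddM /= andNb.
move=> + ->; rewrite add0n -muln2; move: (half _) => h; case: p p7 p4 => // q q7 _ /=.
nia.
Qed.

(* The columns C_ are the coordinate functions dual to the rows B_; T stands for
   the span C^2(g) of the W_i. *)
Record adapted_frame (K : fieldType) (n p : nat) (mu : structure_constants K n) := {
  BX : 'rV[K]_n; BY : 'M[K]_(p, n); BZ : 'M[K]_(p, n); BT : 'M[K]_(p, n);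
  CX : 'cV[K]_n; CY : 'M[K]_(n, p); CZ : 'M[K]_(n, p); CT : 'M[K]_(n, p);
  BX_C : [/\ BX *m CX = 1%:M, BX *m CY = 0, BX *m CZ = 0 & BX *m CT = 0];
  BY_C : [/\ BY *m CX = 0, BY *m CY = 1%:M, BY *m CZ = 0 & BY *m CT = 0];
  BZ_C : [/\ BZ *m CX = 0, BZ *m CY = 0, BZ *m CZ = 1%:M & BZ *m CT = 0];
  BT_C : [/\ BT *m CX = 0, BT *m CY = 0, BT *m CZ = 0 & BT *m CT = 1%:M];
  frame_sum : CX *m BX + CY *m BY + CZ *m BZ + CT *m BT = 1%:M;
  bracket_CX : forall u v, bracket mu u v *m CX = 0;
  bracket_CY : forall u v, bracket mu u v *m CY = 0;
  bracket2_CZ : forall u v w, bracket mu (bracket mu u v) w *m CZ = 0;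
  bracket_XY : forall y, bracket mu BX (y *m BY) = y *m BZ;
  bracket_XZ : forall y, bracket mu BX (y *m BZ) = y *m BT
}.

(** * Brackets and cocycles in an adapted frame *)

Section AdaptedFrame.

Variables (K : fieldType) (n p : nat) (mu : structure_constants K n).
Hypothesis mu3 : in_3Nilp mu.
Variable fr : adapted_frame p mu.

Local Notation X := (BX fr).
Local Notation Y := (BY fr).
Local Notation Z := (BZ fr).
Local Notation T := (BT fr).
Local Notation cX := (CX fr).
Local Notation cY := (CY fr).
Local Notation cZ := (CZ fr).
Local Notation cT := (CT fr).

Let decomp (u : 'rV[K]_n) :
  u = (u *m cX) 0 0 *: X + u *m cY *m Y + u *m cZ *m Z + u *m cT *m T.
Proof.
rewrite -mul_scalar_mx -mx11_scalar -!mulmxA -!mulmxDr.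
by rewrite (frame_sum fr) mulmx1.
Qed.

Lemma bracket_T y w : bracket mu (y *m T) w = 0.
Proof.
have [_ nil] := mu3.
rewrite -(bracket_XZ fr) -(bracket_XY fr).
rewrite (bracket_antisym (BX fr) (bracket mu _ _) mu3).
by rewrite -scaleN1r bracketZl nil scaler0.
Qed.

(** The matrix [1%:M - cT *m T] removes the component in C^2(g), which is central. This is why the
    images of X and Y only matter modulo C^2(g). *)
Lemma bracket_mod_T_l u w : bracket mu (u *m (1%:M - cT *m T)) w = bracket mu u w.
Proof.
rewrite mulmxBr mulmx1 mulmxA -scaleN1r bracketDl bracketZl bracket_T.
by rewrite scaler0 addr0.
Qed.

Lemma bracket_mod_T_r u w : bracket mu u (w *m (1%:M - cT *m T)) = bracket mu u w.
Proof. by rewrite bracket_antisym // bracket_mod_T_l -bracket_antisym. Qed.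

Lemma bracket_Z_cZ y w : bracket mu (y *m Z) w *m cZ = 0.
Proof. by rewrite -(bracket_XY fr) bracket2_CZ. Qed.

(** Brackets with Z are double brackets, without Z-component, and T is central; only [X, Y] and
    [Y, Y] contribute. *)
Lemma bracket_cZ u v :
  bracket mu u v *m cZ = (u *m cX) 0 0 *: (v *m cY) - (v *m cX) 0 0 *: (u *m cY)
     + bracket mu (u *m cY *m Y) (v *m cY *m Y) *m cZ.
Proof.
have Z_r w y : bracket mu w (y *m Z) *m cZ = 0.
  by rewrite bracket_antisym // mulNmx bracket_Z_cZ oppr0.
have T_r w y : bracket mu w (y *m T) = 0.
  by rewrite bracket_antisym // bracket_T oppr0.
have [_ _ Z1 _] := BZ_C fr; have [_ _ T0 _] := BT_C fr; have [[alt _] _] := mu3.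
have X_l w : bracket mu X w *m cZ = w *m cY.
  rewrite {1}(decomp w) !bracketDr bracketZr alt scaler0 add0r T_r addr0.
  rewrite (bracket_XY fr) (bracket_XZ fr) mulmxDl -!mulmxA Z1 T0.
  by rewrite !mulmx0 mulmx1 addr0.
have Y_l y w : bracket mu (y *m Y) w *m cZ =
    bracket mu (y *m Y) (w *m cY *m Y) *m cZ - (w *m cX) 0 0 *: y.
  rewrite {1}(decomp w) !bracketDr T_r addr0 !mulmxDl Z_r addr0 addrC.
  rewrite bracketZr (bracket_antisym _ X) // (bracket_XY fr).
  by rewrite scalerN mulNmx -scalemxAl -(mulmxA y) Z1 mulmx1.
rewrite {1}(decomp u) !bracketDl bracketZl bracket_T addr0 !mulmxDl bracket_Z_cZ.
by rewrite addr0 -scalemxAl X_l Y_l addrA addrAC.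
Qed.

(* Scalar 2-cocycles of g / C^2(g), normalised to vanish when one argument is X; the last
   field recovers the coefficients of a combination of the [phi q]. *)
Record cocycle_family (Q : finType) (phi : Q -> 'rV[K]_n -> 'rV[K]_n -> K)
    (L1 L2 : Q -> 'M[K]_p) := {
  phiD : forall q u u' v, phi q (u + u') v = phi q u v + phi q u' v;
  phiZ : forall q a u v, phi q (a *: u) v = a * phi q u v;
  phi_alt : forall q u, phi q u u = 0;
  phi_anti : forall q u v, phi q u v = - phi q v u;
  phi_T : forall q y v, phi q (y *m T) v = 0;
  phi_XY : forall q y, phi q X (y *m Y) = 0;
  phi_XZ : forall q y, phi q X (y *m Z) = 0;
  phi_mu2 : forall q u v w t, phi q (bracket mu (bracket mu u v) w) t = 0;
  phi_jac : forall q u v w, phi q (bracket mu u v) w + phi q (bracket mu v w) u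
                            + phi q (bracket mu w u) v = 0;
  phi_dual : forall q q', \sum_i \sum_j
      (L1 q i j * phi q' (row i Y) (row j Z) + L2 q i j * phi q' (row i Y) (row j Y))
    = (q == q')%:R
}.

(** An alternating form is applied to the Y-components; a symmetric form pairs Y- with Z-components
    and is antisymmetrised. Brackets have no Y-component, which settles the cocycle condition in the
    first case. In the second, the terms containing an X-coordinate cancel by symmetry, and the rest
    is the cyclic equation for [a]. *)
Lemma cocycle_family_exists :
  exists r, (p * p - ('C(p, 2) + 'C(p, 3)) <= r)%N /\
  exists phi L1 L2, @cocycle_family (incr_pair p + 'I_r)%type phi L1 L2.
Proof.
have [[alt _] _] := mu3.
pose a y z := bracket mu (y *m Y) (z *m Y) *m cZ.
have a_anti y z : a z y = - a y z by rewrite /a bracket_antisym // mulNmx.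
have a_alt y : a y y = 0 by rewrite /a alt mul0mx.
have aD y y' z : a (y + y') z = a y z + a y' z.
  by rewrite /a mulmxDl bracketDl mulmxDl.
have aZ c y z : a (c *: y) z = c *: a y z.
  by rewrite /a -scalemxAl bracketZl scalemxAl.
have [r [S [L [r_ge S_sym S_jac SL]]]] := symmetric_cocycles a_anti a_alt aD aZ.
have [N [M [N_alt NM]]] := alternating_forms K p.
have S_symE l y z : bform (S l) y z = bform (S l) z y by rewrite -bform_tr S_sym.
exists r; split=> //.
pose phi (q : incr_pair p + 'I_r) (u v : 'rV[K]_n) := match q with
  | inl w => bform (N w) (u *m cY) (v *m cY)
  | inr l => bform (S l) (u *m cY) (v *m cZ) - bform (S l) (v *m cY) (u *m cZ)
  end.
exists phi, (fun q => if q is inr l then L l else 0),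
            (fun q => if q is inl w then M w else 0).
have b0l S' (z : 'rV[K]_p) : bform S' 0 z = 0 by rewrite /bform !mul0mx mxE.
have b0r S' (z : 'rV[K]_p) : bform S' z 0 = 0.
  by rewrite /bform trmx0 mulmx0 mxE.
have [BX1 BX2 BX3 BX4] := BX_C fr; have [BY1 BY2 BY3 BY4] := BY_C fr.
have [BZ1 BZ2 BZ3 BZ4] := BZ_C fr; have [BT1 BT2 BT3 BT4] := BT_C fr.
have phiD q u u' v : phi q (u + u') v = phi q u v + phi q u' v.
  case: q => [w|l]; rewrite /phi !mulmxDl ?bformDl ?bformDr //; ring.
have phi_alt q u : phi q u u = 0.
  by case: q => [w|l] /=; [exact: N_alt | rewrite subrr].
have phi_anti q u v : phi q u v = - phi q v u.
  case: q => [w|l] /=; last by rewrite opprB.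
  have := N_alt w (u *m cY + v *m cY).
  rewrite bformDl !bformDr !N_alt addr0 add0r => /eqP.
  by rewrite addr_eq0 => /eqP.
split=> //.
- by move=> q c u v; case: q => [w|l] /=; rewrite -!scalemxAl ?bformZl ?bformZr //; ring.
- move=> q y v; case: q => [w|l] /=; rewrite -!mulmxA BT2 ?BT3 !mulmx0 ?b0l ?b0r //.
  by rewrite subrr.
- move=> q y; case: q => [w|l] /=; first by rewrite BX2 b0l.
  by rewrite BX2 BX3 b0l b0r subrr.
- move=> q y; case: q => [w|l] /=; first by rewrite BX2 b0l.
  by rewrite BX2 BX3 b0l b0r subrr.
- move=> q u v w t; case: q => [m|l] /=; rewrite (bracket_CY fr) ?(bracket2_CZ fr) ?b0l ?b0r //.
  by rewrite subrr.
- move=> q u v w; case: q => [m|l] /=; rewrite !(bracket_CY fr) !b0l ?addr0 //.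
  rewrite (bracket_cZ u v) (bracket_cZ v w) (bracket_cZ w u) -!/(a _ _) !sub0r.
  have := S_jac l (u *m cY) (v *m cY) (w *m cY).
  rewrite !bformDr -![- (_ *: (_ : 'rV[K]_p))]scaleNr !bformZr.
  rewrite (S_symE _ (v *m cY) (u *m cY)) (S_symE _ (w *m cY) (u *m cY)).
  rewrite (S_symE _ (w *m cY) (v *m cY)) => E.
  by rewrite -[RHS]oppr0 -E; ring.
- have rY i : row i Y *m cY = delta_mx 0 i by rewrite -row_mul BY2 row1.
  have rYZ i : row i Y *m cZ = 0 by rewrite -row_mul BY3 row0.
  have rZ i : row i Z *m cZ = delta_mx 0 i by rewrite -row_mul BZ3 row1.
  have rZY i : row i Z *m cY = 0 by rewrite -row_mul BZ2 row0.
  case=> [w|l] [w'|l'] /=.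
  + rewrite -[RHS](NM w w'); apply: eq_bigr => i _; apply: eq_bigr => j _.
    by rewrite mxE mul0r add0r !rY bform_delta.
  + rewrite big1 // => i _; rewrite big1 // => j _.
    by rewrite mxE mul0r add0r !rYZ !b0r subrr mulr0.
  + rewrite big1 // => i _; rewrite big1 // => j _.
    by rewrite rZY b0r mulr0 add0r mxE mul0r.
  + rewrite -[RHS](SL l l'); apply: eq_bigr => i _; apply: eq_bigr => j _.
    by rewrite rZY b0l subr0 rY rZ bform_delta mxE mul0r addr0.
Qed.


(** * The linear family of deformations and its members isomorphic to [mu] *)

Section Family.

Variables (Q : finType) (phi : Q -> 'rV[K]_n -> 'rV[K]_n -> K).
Variables (L1 L2 : Q -> 'M[K]_p).
Hypothesis ph : cocycle_family phi L1 L2.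

Definition perturbation (e : Q * 'I_p -> K) (u v : 'rV[K]_n) : 'rV[K]_n :=
  (\row_k \sum_q phi q u v * e (q, k)) *m T.

Definition deformation (e : Q * 'I_p -> K) : structure_constants K n :=
  sc_of (fun u v => bracket mu u v + perturbation e u v).

Lemma perturbation_linear_l e v : linear (fun u => perturbation e u v).
Proof.
move=> a u u'; rewrite /perturbation scalemxAl -mulmxDl; congr (_ *m _).
apply/rowP => k; rewrite !mxE mulr_sumr -big_split /=; apply: eq_bigr => q _.
by rewrite (phiD ph) (phiZ ph) mulrDl mulrA.
Qed.

Lemma perturbation_anti e u v : perturbation e u v = - perturbation e v u.
Proof.
rewrite /perturbation -mulNmx; congr (_ *m _); apply/rowP => k.
by rewrite !mxE -sumrN; apply: eq_bigr => q _; rewrite (phi_anti ph) mulNr.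
Qed.

Lemma perturbation_linear_r e u : linear (perturbation e u).
Proof.
move=> a v v'; rewrite 3!(perturbation_anti e u) perturbation_linear_l.
by rewrite opprD scalerN.
Qed.

Lemma perturbation_eq0 e u v : (forall q, phi q u v = 0) -> perturbation e u v = 0.
Proof.
move=> phi0; rewrite /perturbation; set r := \row_k _.
suff -> : r = 0 by rewrite mul0mx.
by apply/rowP => k; rewrite !mxE big1 // => q _; rewrite phi0 mul0r.
Qed.

Lemma bracket_deformation e u v :
  bracket (deformation e) u v = bracket mu u v + perturbation e u v.
Proof.
apply: bracket_sc_of => [w|w] a x y.
  by rewrite bracket_linear_l perturbation_linear_l scalerDr addrACA.
by rewrite bracket_linear_r perturbation_linear_r scalerDr addrACA.
Qed.

Lemma deformation_in_3Nilp e : in_3Nilp (deformation e).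
Proof.
apply: in_3Nilp_perturb => // [v|u|u|u v w|u v w|u v w|u v w t].
- exact: perturbation_linear_l.
- exact: perturbation_linear_r.
- by apply: perturbation_eq0 => q; apply: phi_alt ph _ _.
- rewrite /perturbation -!mulmxDl; set r := (_ + _ + _ : 'rV_p).
  suff -> : r = 0 by rewrite mul0mx.
  apply/rowP => k; rewrite !mxE -!big_split big1 //= => q _.
  by rewrite -!mulrDl (phi_jac ph) mul0r.
- by apply: perturbation_eq0 => q; apply: phi_T ph _ _ _.
- exact: bracket_T.
- by apply: perturbation_eq0 => q; apply: phi_mu2 ph _ _ _ _ _.
Qed.

(* Parameters: the components of the images of X and the Y_i modulo C^2(g),
   and (at [None]) the inverse of a determinant. *)
Definition param := option ('I_(1 + p) * 'I_(1 + (p + p))).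

Definition imXY (x : param -> K) : 'M[K]_(1 + p, n) :=
  (\matrix_(i, j) x (Some (i, j))) *m col_mx X (col_mx Y Z).
Definition imX x := usubmx (imXY x).
Definition imY x := dsubmx (imXY x).
(** A morphism from a deformation to [mu] is forced on Z and T by its values on X and Y, since
    bracketing with X is undeformed on Y and Z. *)
Definition imZ x : 'M[K]_(p, n) := \matrix_i bracket mu (imX x) (row i (imY x)).
Definition imT x : 'M[K]_(p, n) := \matrix_i bracket mu (imX x) (row i (imZ x)).
(** The matrix of the map sending X, Y, Z, T to [imX x], [imY x], [imZ x], [imT x]. *)
Definition im x := cX *m imX x + cY *m imY x + cZ *m imZ x + cT *m imT x.

(** When [x None] is the inverse of the determinant, this multiplies by [invmx (im x)]; the adjugate
    keeps it polynomial in [x]. *)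
Definition transported x (u v : 'rV[K]_n) := x None *: (bracket mu u v *m \adj (im x)).

Definition coords (x : param -> K) (qk : Q * 'I_p) : K :=
  \sum_i \sum_j
    (L1 qk.1 i j * ((transported x (row i (imY x)) (row j (imZ x))
                     - bracket mu (row i Y) (row j Z)) *m cT) 0 qk.2
   + L2 qk.1 i j * ((transported x (row i (imY x)) (row j (imY x))
                     - bracket mu (row i Y) (row j Y)) *m cT) 0 qk.2).

(** The component along T_k of the change of bracket is the combination of the [phi q] with
    coefficients [e (q, k)], which [phi_dual] recovers. *)
Lemma perturbation_coords e (d1 d2 : 'I_p -> 'I_p -> 'rV[K]_n) qk :
  (forall i j, d1 i j = bracket (deformation e) (row i Y) (row j Z)) ->
  (forall i j, d2 i j = bracket (deformation e) (row i Y) (row j Y)) ->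
  \sum_i \sum_j
    (L1 qk.1 i j * ((d1 i j - bracket mu (row i Y) (row j Z)) *m cT) 0 qk.2
   + L2 qk.1 i j * ((d2 i j - bracket mu (row i Y) (row j Y)) *m cT) 0 qk.2) = e qk.
Proof.
case: qk => q k /= d1E d2E; have [_ _ _ T1] := BT_C fr.
have E u v : ((bracket (deformation e) u v - bracket mu u v) *m cT) 0 k
    = \sum_q' phi q' u v * e (q', k).
  by rewrite bracket_deformation addrC addKr -mulmxA T1 mulmx1 mxE.
transitivity (\sum_q' (q == q')%:R * e (q', k)); last first.
  rewrite (bigD1 q) //= eqxx mul1r big1 ?addr0 // => q' ne.
  by rewrite eq_sym (negPf ne) mul0r.
under [RHS]eq_bigr => q' _ do rewrite -(phi_dual ph q q') mulr_suml.
rewrite [RHS]exchange_big; apply: eq_bigr => i _ /=.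
under [RHS]eq_bigr => q' _ do rewrite mulr_suml.
rewrite [RHS]exchange_big; apply: eq_bigr => j _ /=.
rewrite d1E d2E !E !mulr_sumr -big_split; apply: eq_bigr => q' _ /=.
by rewrite mulrDl !mulrA.
Qed.

(** The map [im x] built from [f] differs from [f] only on X and Y, and only by elements of C^2(g).
    Neither the brackets of images nor the images of brackets see this difference, so [im x]
    transports [mu] to the deformation as [f] does. *)
Lemma isomorphic_coords e (f : 'M[K]_n) : f \in unitmx ->
  (forall u v, bracket (deformation e) u v = bracket mu (u *m f) (v *m f) *m invmx f) ->
  exists x, coords x =1 e.
Proof.
move=> fU f_iso; pose P := 1%:M - cT *m T.
have PE : P = cX *m X + cY *m Y + cZ *m Z by rewrite /P -(frame_sum fr) addrK.
have f_hom u v : bracket (deformation e) u v *m f = bracket mu (u *m f) (v *m f).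
  by rewrite f_iso mulmxKV.
pose C := row_mx cX (row_mx cY cZ); pose XY := col_mx X Y.
pose M := XY *m f *m C.
(* [im] does not read the coordinate [None], so the dummy value 0 there allows the determinant to be
   computed before its inverse is stored. *)
pose x0 (i : param) := if i is Some ij then M ij.1 ij.2 else 0.
pose x (i : param) := if i is Some ij then M ij.1 ij.2 else (\det (im x0))^-1.
have imE : im x = im x0 by [].
have imXYE : imXY x = XY *m f *m P.
  rewrite /imXY; have -> : \matrix_(i, j) x (Some (i, j)) = M.
    by apply/matrixP => i j; rewrite mxE.
  by rewrite /M -mulmxA /C !mul_row_col addrA -PE.
have imXE : imX x = X *m f *m P by rewrite /imX imXYE /XY -!mul_usub_mx col_mxKu.
have imYE : imY x = Y *m f *m P by rewrite /imY imXYE /XY -!mul_dsub_mx col_mxKd.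
have rP (A : 'M[K]_(p, n)) i : row i (A *m f *m P) = row i A *m f *m P.
  by rewrite !row_mul.
have psi_XY y : perturbation e X (y *m Y) = 0.
  by apply: perturbation_eq0 => q; apply: phi_XY ph _ _.
have psi_XZ y : perturbation e X (y *m Z) = 0.
  by apply: perturbation_eq0 => q; apply: phi_XZ ph _ _.
have imZE : imZ x = Z *m f.
  apply/row_matrixP => i; rewrite rowK imXE imYE rP bracket_mod_T_l bracket_mod_T_r.
  rewrite -f_hom bracket_deformation row_mul !rowE psi_XY addr0.
  by rewrite (bracket_XY fr).
have imTE : imT x = T *m f.
  apply/row_matrixP => i; rewrite rowK imXE imZE bracket_mod_T_l row_mul.
  rewrite -f_hom bracket_deformation row_mul !rowE psi_XZ addr0.
  by rewrite (bracket_XZ fr).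
have bZ u v w : bracket mu u (bracket mu v w) *m cZ = 0.
  by rewrite bracket_antisym // mulNmx (bracket2_CZ fr) oppr0.
(* The rows of T are double brackets, and [f] carries them to double brackets of [mu], which lie in
   the span of T. *)
have f_T : T *m f *m P = 0.
  apply/row_matrixP => i; rewrite row_mul -imTE rowK imZE row_mul row0.
  have -> : row i Z *m f = bracket mu (X *m f) (row i Y *m f).
    by rewrite -f_hom bracket_deformation !rowE psi_XY addr0 (bracket_XY fr).
  by rewrite PE !mulmxDr !mulmxA (bracket_CX fr) (bracket_CY fr) bZ !mul0mx !addr0.
(* [N] is the matrix of [f] restricted to C^2(g), invertible because [f] is injective. *)
pose N := T *m f *m cT.
have NE : N *m T = T *m f.
  by rewrite /N -!mulmxA; move: f_T; rewrite /P mulmxBr mulmx1 !mulmxA => /subr0_eq.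
have [X1 X2 X3 X4] := BX_C fr; have [Y1 Y2 Y3 Y4] := BY_C fr.
have [Z1 Z2 Z3 Z4] := BZ_C fr; have [T1 T2 T3 T4] := BT_C fr.
have T_free : row_free T by apply/row_freeP; exists cT.
have NU : N \in unitmx.
  rewrite -row_free_unit -row_leq_rank -(mxrankMfree N T_free) NE.
  by rewrite mxrankMfree ?row_free_unit // row_leq_rank.
have T_iso : T = invmx N *m (T *m f) by rewrite -NE mulKmx.
have imEf : im x = f - (cX *m X + cY *m Y) *m f *m cT *m T.
  rewrite /im imXE imYE imZE imTE !mulmxA -!mulmxDl -addrA -mulmxDl.
  rewrite {1}/P mulmxBr mulmx1 !mulmxA addrAC -mulmxDl addrA (frame_sum fr).
  by rewrite mul1mx.
(* If [im x] kills v, then v f lies in the span of T, which [f] maps onto itself; so v lies there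
   too, the correction vanishes on v, and v f = 0. *)
have imU : im x \in unitmx.
  rewrite -row_free_unit; apply: inj_row_free => v v0.
  have vf : v *m f = v *m (cX *m X + cY *m Y) *m f *m cT *m T.
    by apply/eqP; rewrite -subr_eq0 -v0 imEf mulmxBr !mulmxA.
  have vT : v = v *m (cX *m X + cY *m Y) *m f *m cT *m invmx N *m T.
    apply: (row_free_inj (A := f)); first by rewrite row_free_unit.
    by rewrite vf [in LHS]T_iso !mulmxA.
  have vX : v *m cX = 0 by rewrite vT -mulmxA T1 mulmx0.
  have vY : v *m cY = 0 by rewrite vT -mulmxA T2 mulmx0.
  apply: (row_free_inj (A := f)); first by rewrite row_free_unit.
  by rewrite vf mulmxDr !mulmxA vX vY !mul0mx addr0 !mul0mx.
(* Brackets have no X- or Y-component, so [im x] and [f] agree on them. *)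
have im_nu u v : bracket (deformation e) u v *m im x = bracket mu (u *m f) (v *m f).
  rewrite -f_hom; set d := bracket (deformation e) u v.
  have dX : d *m cX = 0.
    by rewrite /d bracket_deformation mulmxDl (bracket_CX fr) -mulmxA T1 mulmx0 addr0.
  have dY : d *m cY = 0.
    by rewrite /d bracket_deformation mulmxDl (bracket_CY fr) -mulmxA T2 mulmx0 addr0.
  by rewrite imEf mulmxBr !mulmxA mulmxDr !mulmxA dX dY !mul0mx addr0 !mul0mx subr0.
have transE u v : transported x (u *m f *m P) v = transported x (u *m f) v.
  by rewrite /transported bracket_mod_T_l.
have transPE u v : transported x u (v *m f *m P) = transported x u (v *m f).
  by rewrite /transported bracket_mod_T_r.
have nuE u v : bracket (deformation e) u v = transported x (u *m f) (v *m f).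
  rewrite /transported -im_nu scalemxAr.
  have -> : x None *: \adj (im x) = invmx (im x) by rewrite /invmx imU imE.
  by rewrite mulmxK.
exists x => qk; apply: perturbation_coords => i j.
  by rewrite nuE imYE imZE rP transE row_mul.
by rewrite nuE imYE !rP transE transPE.
Qed.

End Family.

End AdaptedFrame.

(** * Matrices with polynomial entries *)

Definition polymx (K : fieldType) (I : finType) m n (A : (I -> K) -> 'M[K]_(m, n)) :=
  forall i j, polyfun (fun x => A x i j).

Section PolynomialMatrices.

Variables (K : fieldType) (I : finType).

Lemma polymx_const m n (A : 'M[K]_(m, n)) : polymx (fun _ : I -> K => A).
Proof. by move=> i j; apply: polyfun_const. Qed.

Lemma polymxD m n (A B : (I -> K) -> 'M[K]_(m, n)) :
  polymx A -> polymx B -> polymx (fun x => A x + B x).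
Proof.
move=> AP BP i j; apply: (@eq_polyfun _ _ _ (fun x => A x i j + B x i j)).
  by move=> x; rewrite mxE.
exact: polyfunD.
Qed.

Lemma polymxZ m n (c : (I -> K) -> K) (A : (I -> K) -> 'M[K]_(m, n)) :
  polyfun c -> polymx A -> polymx (fun x => c x *: A x).
Proof.
move=> cP AP i j; apply: (@eq_polyfun _ _ _ (fun x => c x * A x i j)).
  by move=> x; rewrite mxE.
exact: polyfunM.
Qed.

Lemma polymxM m n q (A : (I -> K) -> 'M[K]_(m, n)) (B : (I -> K) -> 'M[K]_(n, q)) :
  polymx A -> polymx B -> polymx (fun x => A x *m B x).
Proof. by move=> AP BP i j; apply: polyfun_mulmx. Qed.

Lemma polymx_row m n (A : (I -> K) -> 'M[K]_(m, n)) i :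
  polymx A -> polymx (fun x => row i (A x)).
Proof. by move=> AP k j; apply: eq_polyfun (AP i j) => x; rewrite mxE. Qed.

Lemma polymx_bracket n (mu : structure_constants K n) (U V : (I -> K) -> 'rV[K]_n) :
  polymx U -> polymx V -> polymx (fun x => bracket mu (U x) (V x)).
Proof.
move=> UP VP i k; apply: (@eq_polyfun _ _ _
  (fun x => \sum_a \sum_b U x 0 a * V x 0 b * mu (a, b, k))).
  by move=> x; rewrite mxE.
apply: polyfun_sum => a; apply: polyfun_sum => b.
apply: polyfunM; last exact: polyfun_const.
by apply: polyfunM.
Qed.

End PolynomialMatrices.

(** * Non-rigidity from the parameter count *)

Section NonRigidity.

Variables (K : fieldType) (n p : nat) (mu : structure_constants K n).
Hypothesis (mu3 : in_3Nilp mu).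
Variable fr : adapted_frame p mu.
Variables (Q : finType) (phi : Q -> 'rV[K]_n -> 'rV[K]_n -> K).
Variables (L1 L2 : Q -> 'M[K]_p).
Hypothesis ph : cocycle_family fr phi L1 L2.

Lemma coords_poly qk : polyfun (fun x => coords fr L1 L2 x qk).
Proof.
have XYP : polymx (imXY fr).
  apply: polymxM; last exact: polymx_const.
  by move=> i j; apply: eq_polyfun (polyfun_var _ (Some (i, j))) => x; rewrite mxE.
have XP : polymx (imX fr).
  by move=> i j; apply: eq_polyfun (XYP (lshift p i) j) => x; rewrite mxE.
have YP : polymx (imY fr).
  by move=> i j; apply: eq_polyfun (XYP (rshift 1 i) j) => x; rewrite mxE.
have ZP : polymx (imZ fr).
  move=> i j; apply: (@eq_polyfun _ _ _
    (fun x => bracket mu (imX fr x) (row i (imY fr x)) 0 j)).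
    by move=> x; rewrite mxE.
  by apply: polymx_bracket => //; apply: polymx_row.
have TP : polymx (imT fr).
  move=> i j; apply: (@eq_polyfun _ _ _
    (fun x => bracket mu (imX fr x) (row i (imZ fr x)) 0 j)).
    by move=> x; rewrite mxE.
  by apply: polymx_bracket => //; apply: polymx_row.
have imP : polymx (im fr).
  by do 3?[apply: polymxD]; apply: polymxM => //; apply: polymx_const.
have adjP : polymx (fun x => \adj (im fr x)) by move=> i j; apply: polyfun_adj.
have transP U V : polymx U -> polymx V -> polymx (fun x => transported fr x (U x) (V x)).
  move=> UP VP; apply: polymxZ; first exact: polyfun_var.
  by apply: polymxM => //; apply: polymx_bracket.
have entryP W (w : 'rV[K]_n) : polymx W ->
    polyfun (fun x : param p -> K => ((W x - w) *m CT fr) 0 qk.2).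
  move=> WP; apply: polymxM; last exact: polymx_const.
  by apply: polymxD => //; apply: polymx_const.
apply: polyfun_sum => i; apply: polyfun_sum => j.
by apply: polyfunD; apply: polyfunM; first [exact: polyfun_const |
  apply: entryP; apply: transP; apply: polymx_row].
Qed.

Lemma deformation_poly ijk : polyfun (fun e => deformation fr phi e ijk).
Proof.
apply: (@eq_polyfun _ _ _ (fun e => (bracket mu (delta_mx 0 ijk.1.1) (delta_mx 0 ijk.1.2)
    + perturbation fr phi e (delta_mx 0 ijk.1.1) (delta_mx 0 ijk.1.2)) 0 ijk.2)).
  by move=> e; rewrite ffunE.
apply: polymxD; first exact: polymx_const.
apply: polymxM; last exact: polymx_const.
move=> i k; apply: (@eq_polyfun _ _ _ (fun e => \sum_q
    phi q (delta_mx 0 ijk.1.1) (delta_mx 0 ijk.1.2) * e (q, k))).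
  by move=> e; rewrite mxE.
by apply: polyfun_sum => q; apply: polyfunM; [exact: polyfun_const | exact: polyfun_var].
Qed.

Lemma deformation0 : deformation fr phi (fun _ => 0) = mu.
Proof.
apply/ffunP => -[[i j] k]; rewrite ffunE /perturbation /=.
set r := \row_k _; have -> : r = 0.
  by apply/rowP => l; rewrite !mxE big1 // => q _; rewrite mulr0.
rewrite mul0mx addr0 mxE (bigD1 i) //= (bigD1 j) //= !big1 ?addr0.
- by rewrite !mxE !eqxx !mul1r.
- by move=> i' ne; rewrite big1 // => j' _; rewrite !mxE (negPf ne) !mul0r.
- by move=> j' ne; rewrite !mxE (negPf ne) mulr0 mul0r.
Qed.

Lemma not_rigid_of_cocycles : [pchar K] =i pred0 ->
  ((p.+1 * (p + p).+1).+1 < #|Q| * p)%N -> ~ rigid_in_3Nilp mu.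
Proof.
move=> charK0 dim [_ [U [S US] orbU]].
have Umu : U mu.
  apply: (proj2 ((orbU mu).1 _)).
  exists 1%:M; first exact: unitmx1.
  by move=> u v; rewrite invmx1 !mulmx1.
(* If every polynomial of [S] vanished at [mu], then [mu] would be outside [U]; so some [R] in [S]
   is nonzero at [mu], the member of the family with parameter 0. *)
apply: (proj2 (US mu)) (Umu) => R SR; apply/eqP; apply/negPn/negP => R0.
pose h e := sc_eval R (deformation fr phi e).
have hP : polyfun h by apply: polyfun_meval => a; apply: deformation_poly.
have h0 : h (fun _ => 0) != 0 by rewrite /h deformation0.
have ltIJ : (#|{: param p}| < #|{: Q * 'I_p}|)%N.
  by rewrite card_option !card_prod !card_ord.
have [e he noe] := polyfun_not_dominant charK0 ltIJ coords_poly hP h0.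
(* Openness yields membership in [U] only up to double negation, which suffices to derive a
   contradiction. *)
have : ~ ~ U (deformation fr phi e).
  by move/(US _) => /(_ R SR) /eqP; apply/negP.
apply=> Ue; have [f fU f_iso] :=
  (orbU _).2 (conj (deformation_in_3Nilp mu3 ph e) Ue).
have [x xE] := isomorphic_coords mu3 ph fU f_iso.
exact: (noe x).
Qed.

End NonRigidity.

Lemma adapted_not_rigid (K : fieldType) n p (mu : structure_constants K n) :
  [pchar K] =i pred0 -> (4 <= p)%N -> adapted_frame p mu -> ~ rigid_in_3Nilp mu.
Proof.
move=> charK0 p4 fr rig; have [mu3 _] := rig.
have [r [r_ge [phi [L1 [L2 ph]]]]] := cocycle_family_exists mu3 fr.
apply: (not_rigid_of_cocycles mu3 ph charK0) rig.
apply: leq_trans (dimension_count p4) _.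
by rewrite leq_mul2r card_sum card_incr_pair card_ord leq_add2l r_ge orbT.
Qed.

(** * Construction of an adapted frame *)

Lemma mul_ad (K : fieldType) n (mu : structure_constants K n) X v :
  v *m ad mu X = bracket mu X v.
Proof. exact: mul_rV_lin1. Qed.

Lemma ad_cube (K : fieldType) n (mu : structure_constants K n) X :
  in_3Nilp mu -> ad mu X *m ad mu X *m ad mu X = 0.
Proof.
move=> mu3; have [_ nil] := mu3; apply/row_matrixP => i.
rewrite row0 rowE !mulmxA !mul_ad.
rewrite (bracket_antisym X (bracket mu X (bracket _ _ _))) //.
rewrite (bracket_antisym X (bracket mu X _)) //.
by rewrite -!scaleN1r bracketZl nil !scaler0.
Qed.

(** Lift p independent vectors T of the image of ad(X)^2 to Y and put Z = [X, Y]. Applying ad(X)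
    twice to a linear relation kills its coefficients on Y, then on Z; X is independent of the rest
    because it is outside [g, g]. As n = 3p + 1 this is a basis, and the inverse matrix supplies the
    dual coordinates. *)
Lemma adapted_frame_exists (K : fieldType) n p (mu : structure_constants K n) X :
  n = (3 * p + 1)%N -> in_3Nilp mu -> X \notin derived_algebra mu ->
  (p <= \rank (ad mu X *m ad mu X))%N -> inhabited (adapted_frame p mu).
Proof.
move=> n_eq mu3 XD; set A := ad mu X => rkA.
have [[alt _] nil] := mu3.
have A3 : A *m A *m A = 0 by apply: ad_cube.
have XA : X *m A = 0 by rewrite mul_ad.
have [Y [Z [T [YA ZA TA T_free]]]] : exists Y Z T : 'M_(p, n),
    [/\ Y *m A = Z, Z *m A = T, T *m A = 0 & row_free T].
  (* The rows of [D] are preimages of a basis of the image of [A *m A], and [pid_mx p] keeps p of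
     them. *)
  have [D DE] : exists D, row_base (A *m A) = D *m (A *m A).
    by apply/submxP; rewrite eq_row_base.
  exists (pid_mx p *m D), (pid_mx p *m D *m A), (pid_mx p *m D *m A *m A).
  split=> //; first by rewrite -!mulmxA (mulmxA A) A3 !mulmx0.
  rewrite -!mulmxA -DE -row_leq_rank mxrankMfree ?row_base_free //.
  by rewrite rank_pid_mx.
have T0 (b : 'rV_p) : b *m T = 0 -> b = 0.
  by move=> bT; apply: (row_free_inj T_free); rewrite bT mul0mx.
have notX (a : 'M_1) t : t \in derived_algebra mu ->
    a *m X + t \in derived_algebra mu -> a = 0.
  move=> tD; rewrite rpredDr // [a]mx11_scalar mul_scalar_mx rpredZeq (negPf XD).
  by rewrite orbF => /eqP ->; rewrite raddf0.
have ZD (b : 'rV_p) : b *m Z \in derived_algebra mu.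
  by rewrite -YA mulmxA mul_ad bracket_derived.
have TD (b : 'rV_p) : b *m T \in derived_algebra mu.
  by rewrite -ZA mulmxA mul_ad bracket_derived.
have indep (a : 'M_1) (b c d : 'rV_p) :
    a *m X + b *m Y + c *m Z + d *m T = 0 -> [/\ a = 0, b = 0, c = 0 & d = 0].
  move=> E; have EA : b *m Z + c *m T = 0.
    move/(congr1 (mulmx^~ A)): E; rewrite /= !mulmxDl -!mulmxA XA TA ZA YA.
    by rewrite !mulmx0 mul0mx add0r addr0.
  have b0 : b = 0.
    apply: T0; move/(congr1 (mulmx^~ A)): EA.
    by rewrite /= mulmxDl -!mulmxA TA ZA mulmx0 mul0mx addr0.
  have c0 : c = 0 by apply: T0; rewrite -EA b0 mul0mx add0r.
  have a0 : a = 0.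
    apply: (notX a (d *m T)); first exact: TD.
    by move: E; rewrite b0 c0 !mul0mx !addr0 => ->; apply: rpred0.
  by split=> //; apply: T0; rewrite -E a0 b0 c0 !mul0mx !add0r.
pose m := (1 + (p + (p + p)))%N.
pose B : 'M_(m, n) := col_mx X (col_mx Y (col_mx Z T)).
have B_free : row_free B.
  apply: inj_row_free => v; rewrite -[v]hsubmxK -[rsubmx v]hsubmxK.
  rewrite -[rsubmx (rsubmx v)]hsubmxK !mul_row_col !addrA.
  by move/indep => [-> -> -> ->]; rewrite !row_mx0.
have B_full : row_full B.
  by rewrite /row_full (eqP B_free) n_eq /m; apply/eqP; lia.
pose C := pinvmx B.
have BC : B *m C = 1%:M by apply: mulmxVp.
have CB : C *m B = 1%:M by apply: mulVpmx.
pose IX : 'M[K]_(1, m) := row_mx 1%:M 0.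
pose IY : 'M[K]_(p, m) := row_mx 0 (row_mx 1%:M 0).
pose IZ : 'M[K]_(p, m) := row_mx 0 (row_mx 0 (row_mx 1%:M 0)).
pose IT : 'M[K]_(p, m) := row_mx 0 (row_mx 0 (row_mx 0 1%:M)).
have Isum : IX^T *m IX + IY^T *m IY + IZ^T *m IZ + IT^T *m IT = 1%:M.
  rewrite /IX /IY /IZ /IT !tr_row_mx !trmx1 !trmx0 !mul_col_row.
  rewrite !(mul0mx, mulmx0, mul1mx) !(add_block_mx, addr0, add0r).
  by rewrite -!scalar_mx_block.
have XE : X = IX *m B by rewrite mul_row_col mul1mx mul0mx addr0.
have YE : Y = IY *m B by rewrite !mul_row_col mul1mx !mul0mx addr0 add0r.
have ZE : Z = IZ *m B by rewrite !mul_row_col mul1mx !mul0mx addr0 !add0r.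
have TE : T = IT *m B by rewrite !mul_row_col mul1mx !mul0mx !add0r.
have dual k l (U : 'M[K]_(k, m)) (V : 'M[K]_(m, l)) : U *m B *m (C *m V) = U *m V.
  by rewrite -mulmxA (mulmxA B) BC mul1mx.
pose CX := C *m IX^T; pose CY := C *m IY^T.
pose CZ := C *m IZ^T; pose CT := C *m IT^T.
have lift_dual : (forall k (U : 'M[K]_(k, m)) (v : 'M[K]_(k, n)), v = U *m B ->
   [/\ v *m CX = U *m IX^T, v *m CY = U *m IY^T, v *m CZ = U *m IZ^T &
       v *m CT = U *m IT^T]) by move=> k U v ->; split; apply: dual.
have XC : [/\ X *m CX = 1%:M, X *m CY = 0, X *m CZ = 0 & X *m CT = 0].
  have [-> -> -> ->] := lift_dual _ _ _ XE.
  by split; rewrite !tr_row_mx !trmx1 !trmx0 !mul_row_col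
     !(mul0mx, mulmx0, mul1mx, addr0, add0r).
have YC : [/\ Y *m CX = 0, Y *m CY = 1%:M, Y *m CZ = 0 & Y *m CT = 0].
  have [-> -> -> ->] := lift_dual _ _ _ YE.
  by split; rewrite !tr_row_mx !trmx1 !trmx0 !mul_row_col
     !(mul0mx, mulmx0, mul1mx, addr0, add0r).
have ZC : [/\ Z *m CX = 0, Z *m CY = 0, Z *m CZ = 1%:M & Z *m CT = 0].
  have [-> -> -> ->] := lift_dual _ _ _ ZE.
  by split; rewrite !tr_row_mx !trmx1 !trmx0 !mul_row_col
     !(mul0mx, mulmx0, mul1mx, addr0, add0r).
have TC : [/\ T *m CX = 0, T *m CY = 0, T *m CZ = 0 & T *m CT = 1%:M].
  have [-> -> -> ->] := lift_dual _ _ _ TE.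
  by split; rewrite !tr_row_mx !trmx1 !trmx0 !mul_row_col
     !(mul0mx, mulmx0, mul1mx, addr0, add0r).
have Csum : CX *m X + CY *m Y + CZ *m Z + CT *m T = 1%:M.
  have lift k (U : 'M[K]_(k, m)) : C *m U^T *m (U *m B) = C *m (U^T *m U) *m B.
    by rewrite !mulmxA.
  by rewrite XE YE ZE TE !lift -!mulmxDl -!mulmxDr Isum mulmx1.
clearbody CX CY CZ CT.
have dec (d : 'rV_n) : d = d *m CX *m X + d *m CY *m Y + d *m CZ *m Z + d *m CT *m T.
  by rewrite -!mulmxA -!mulmxDr Csum mulmx1.
have decA (d : 'rV_n) : d *m A = d *m CY *m Z + d *m CZ *m T.
  rewrite {1}[d]dec !mulmxDl -!mulmxA XA TA ZA YA.
  by rewrite !mulmx0 add0r addr0.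
have [_ _ ZCZ _] := ZC; have [_ _ TCZ _] := TC.
(* By 3-step nilpotency [A] kills a double bracket, while it sends Y- and Z-components injectively
   to Z and T. *)
have C2 u v w (d := bracket mu (bracket mu u v) w) : d *m CY = 0 /\ d *m CZ = 0.
  have dA : d *m CY *m Z + d *m CZ *m T = 0.
    by rewrite -decA mul_ad bracket_antisym // nil oppr0.
  suff d0 : d *m CY = 0.
    by split=> //; apply: T0; rewrite -dA d0 mul0mx add0r.
  apply: T0; move/(congr1 (mulmx^~ A)): dA.
  by rewrite /= mulmxDl -!mulmxA TA ZA !mulmx0 mul0mx addr0 !mulmxA.
(* The Y-component of [u, v] is the Z-component of [X, [u, v]], a double bracket up to sign. *)
have C1Y u v : bracket mu u v *m CY = 0.
  have := congr1 (mulmx^~ CZ) (decA (bracket mu u v)).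
  rewrite /= mulmxDl -!(mulmxA _ _ CZ) ZCZ TCZ mulmx1 mulmx0 addr0 => <-.
  by rewrite mulmxA mul_ad bracket_antisym // mulNmx (C2 u v X).2 oppr0.
(* Z and T lie in [g, g] and X does not, so a bracket has no X-component. *)
have C1X u v : bracket mu u v *m CX = 0.
  pose d := bracket mu u v.
  apply: (notX _ (d *m CZ *m Z + d *m CT *m T)); first by rewrite rpredD.
  have := dec d; rewrite C1Y mul0mx addr0 -addrA => <-.
  exact: bracket_derived.
constructor; apply: (@Build_adapted_frame K n p mu X Y Z T CX CY CZ CT) => //.
- by move=> u v w; case: (C2 u v w).
- by move=> y; rewrite -mul_ad -mulmxA YA.
- by move=> y; rewrite -mul_ad -mulmxA ZA.
Qed.

(** * Jordan blocks of size 3 and the rank of ad(X)^2 *)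

Lemma mul_mxdiag_mxdiag (R : pzSemiRingType) k (q : 'I_k -> nat)
    (D D' : forall i, 'M[R]_(q i)) :
  \mxdiag_i D i *m \mxdiag_i D' i = \mxdiag_i (D i *m D' i).
Proof.
rewrite [\mxdiag_i D' i]/mxdiag mul_mxdiag_mxblock; apply/eq_mxblock => i j.
by case: eqVneq => [<-|_]; rewrite ?conform_mx_id ?mulmx0.
Qed.

Lemma jordan_block3_sqr_neq0 (K : fieldType) (a : K) :
  jordan_block 3 a *m jordan_block 3 a != 0.
Proof.
(* The corner entry (0, 2) of the square is 1 whatever the eigenvalue. *)
apply/eqP => /matrixP /(_ ord0 ord_max) /eqP.
by rewrite !mxE !big_ord_recl big_ord0 !mxE /= !mulr0n !(add0r, mul0r, mulr0, addr0) mulr1 oner_eq0.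
Qed.

(** The square of the Jordan matrix is block diagonal, and each block of size 3 contributes at least
    1 to its rank. *)
Lemma rank_sqr_of_jordan_sizes (K : fieldType) n (A : 'M[K]_n) s :
  jordan_sizes A s -> (count_mem 3 s <= \rank (A *m A))%N.
Proof.
case=> _ _ [a [P [P_free _ PA]]].
have PAA : P *m (A *m A) = jordan_matrix a *m jordan_matrix a *m P.
  by rewrite mulmxA PA -mulmxA PA mulmxA.
apply: leq_trans (mxrankM_maxr P _); rewrite PAA mxrankMfree //.
rewrite /jordan_matrix mul_mxdiag_mxdiag rank_mxdiag.
rewrite -sum1_count big_mkcond (big_nth 0%N) big_mkord; apply: leq_sum => i _ /=.
case: eqP => // s3; rewrite lt0n mxrank_eq0.
move: (a i); rewrite s3 => b; exact: jordan_block3_sqr_neq0.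
Qed.

Theorem proposition20 (K : closedFieldType) (charK0 : [pchar K] =i pred0)
    (p : nat) (hp : (4 <= p)%N) (mu : structure_constants K (3 * p + 1)) :
  in_family_F mu -> ~ rigid_in_3Nilp mu.
Proof.
(* The vector attaining the characteristic sequence has p Jordan blocks of size 3, so the square of
   its adjoint has rank at least p. *)
case=> -[mu3 _] [[X XD /rank_sqr_of_jordan_sizes rk] _].
rewrite -cats1 count_cat count_nseq /= mul1n !addn0 in rk.
have [fr] := adapted_frame_exists (erefl _) mu3 XD rk.
exact: adapted_not_rigid charK0 hp fr.
Qed.
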